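(* For every real $\alpha\ne0$, there are no rotational (spacelike) $K^\alpha$-translators with timelike axis intersecting the rotation axis orthogonally. On the other hand, if $\alpha\in(0,1/2)$, there are rotational (spacelike) $K^\alpha$-translators with timelike axis intersecting the rotation axis at a conical point.
   Context: $\mathbb R_1^3$ is $\mathbb R^3$ with the metric $\langle,\rangle=dx^2+dy^2-dz^2$. A surface is spacelike if its induced metric is Riemannian; then its unit normal $N$ satisfies $\langle N,N\rangle=\epsilon=-1$. The Gauss curvature is $K=\epsilon\det(A)$, where $AU=-\nabla^0_U N$ is the Weingarten map and $\nabla^0$ is the Levi-Civita connection of $\mathbb R_1^3$. In a local parametrization $X(u,v)$, $$K=-\frac{\det(X_u,X_v,X_{uu})\det(X_u,X_v,X_{vv})-\det(X_u,X_v,X_{uv})^2}{(EG-F^2)^2},$$ where $E=\langle X_u,X_u\rangle$, $F=\langle X_u,X_v\rangle$, $G=\langle X_v,X_v\rangle$. A spacelike surface is a $K^\alpha$-translator with speed $\vec v\in\mathbb R_1^3$ if $K>0$ and $K^\alpha=\langle N,\vec v\rangle$ everywhere, for a choice of unit normal $N$. A surface of revolution with timelike axis is, after a rigid motion of $\mathbb R_1^3$, one whose axis is the $z$-axis, parametrized by $X(r,\theta)=(r\cos\theta,r\sin\theta,f(r))$ with $f$ smooth on an interval of $r>0$; it is spacelike iff $f'^2<1$. When the generating curve $r\mapsto(r,0,f(r))$ is defined on an interval $(0,\delta)$ and extends to the limit $r\to0$, the surface intersects the axis orthogonally if $\lim_{r\to0}f'(r)=0$, and intersects it at a conical point (a point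 where the metric is degenerate) if $\lim_{r\to0}f'(r)^2=1$. *)

(* Defs.v *)
From Stdlib Require Import Reals.
From Coquelicot Require Import Coquelicot.
Open Scope R_scope.

Definition vec : Type := (R * R * R)%type.

Definition cx (p : vec) : R := fst (fst p).
Definition cy (p : vec) : R := snd (fst p).
Definition cz (p : vec) : R := snd p.

Definition ldot (p q : vec) : R := cx p * cx q + cy p * cy q - cz p * cz q.

Definition linear_map (L : vec -> vec) : Prop :=
  (forall p q : vec, L (plus p q) = plus (L p) (L q)) /\
  (forall (k : R) (p : vec), L (scal k p) = scal k (L p)).

(* The full isometry group of the Minkowski space: no orientation or
   time-orientation is required to be preserved. *)
Definition rigid_motion (phi : vec -> vec) : Prop :=
  exists (L : vec -> vec) (b : vec),
    linear_map L /\
    (forall p q : vec, ldot (L p) (L q) = ldot p q) /\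
    (forall p : vec, phi p = plus (L p) b).

(* Parametrizations are total maps [R -> R -> vec], only considered on an
   open domain [U : R -> R -> Prop]; [smooth_on] is C^infinity on [U]. *)
Definition smooth_on (U : R -> R -> Prop) (X : R -> R -> vec) : Prop :=
  forall (n : nat) (u v : R), U u v ->
    ex_diff_n (fun s t => cx (X s t)) n u v /\
    ex_diff_n (fun s t => cy (X s t)) n u v /\
    ex_diff_n (fun s t => cz (X s t)) n u v.

Definition d_u (X : R -> R -> vec) (u v : R) : vec :=
  (Derive (fun s => cx (X s v)) u,
   Derive (fun s => cy (X s v)) u,
   Derive (fun s => cz (X s v)) u).

Definition d_v (X : R -> R -> vec) (u v : R) : vec :=
  (Derive (fun t => cx (X u t)) v,
   Derive (fun t => cy (X u t)) v,
   Derive (fun t => cz (X u t)) v).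

(* The induced metric, evaluated at a X_u + b X_v, is positive definite; in
   particular X is an immersion. *)
Definition spacelike_surface (U : R -> R -> Prop) (X : R -> R -> vec) : Prop :=
  smooth_on U X /\
  forall u v : R, U u v ->
    forall a b : R, (a, b) <> (0, 0) ->
      let w : vec := plus (scal a (d_u X u v)) (scal b (d_v X u v)) in
      0 < ldot w w.

Definition unit_normal (U : R -> R -> Prop) (X N : R -> R -> vec) : Prop :=
  smooth_on U N /\
  forall u v : R, U u v ->
    ldot (N u v) (d_u X u v) = 0 /\
    ldot (N u v) (d_v X u v) = 0 /\
    ldot (N u v) (N u v) = -1.

(* ((a11, a12), (a21, a22)) is the matrix, in the basis (X_u, X_v), of the
   Weingarten map A W = - nabla^0_W N; the Levi-Civita connection nabla^0 of
   the flat ambient metric is componentwise differentiation. *)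
Definition weingarten_matrix (X N : R -> R -> vec) (u v : R)
    (a11 a12 a21 a22 : R) : Prop :=
  opp (d_u N u v) = plus (scal a11 (d_u X u v)) (scal a21 (d_v X u v)) /\
  opp (d_v N u v) = plus (scal a12 (d_u X u v)) (scal a22 (d_v X u v)).

(* K = epsilon det A with epsilon = <N, N>. *)
Definition gauss_curvature (X N : R -> R -> vec) (u v K : R) : Prop :=
  exists a11 a12 a21 a22 : R,
    weingarten_matrix X N u v a11 a12 a21 a22 /\
    K = ldot (N u v) (N u v) * (a11 * a22 - a12 * a21).

Definition K_translator (alpha : R) (speed : vec)
    (U : R -> R -> Prop) (X : R -> R -> vec) : Prop :=
  spacelike_surface U X /\
  exists N : R -> R -> vec,
    unit_normal U X N /\
    forall u v : R, U u v ->
      exists K : R,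
        gauss_curvature X N u v K /\
        0 < K /\
        Rpower K alpha = ldot (N u v) speed.

Definition rot_domain (delta : R) (r theta : R) : Prop := 0 < r < delta.

(* Image under phi of the rotational surface about the z-axis generated by
   r |-> (r, 0, f r). *)
Definition rot_surface (phi : vec -> vec) (f : R -> R) (r theta : R) : vec :=
  phi (r * cos theta, r * sin theta, f r).

Definition rotational_K_translator (alpha : R) (speed : vec)
    (phi : vec -> vec) (f : R -> R) (delta : R) : Prop :=
  rigid_motion phi /\
  0 < delta /\
  (forall (n : nat) (r : R), 0 < r < delta -> ex_derive_n f n r) /\
  K_translator alpha speed (rot_domain delta) (rot_surface phi f).

Definition reaches_axis (f : R -> R) : Prop :=
  exists z0 : R, filterlim f (at_right 0) (locally z0).

Definition meets_axis_orthogonally (f : R -> R) : Prop :=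
  reaches_axis f /\
  filterlim (fun r => Derive f r) (at_right 0) (locally 0).

Definition meets_axis_at_conical_point (f : R -> R) : Prop :=
  reaches_axis f /\
  filterlim (fun r => Derive f r ^ 2) (at_right 0) (locally 1).

(* Main.v *)
(* Along the rotational surface, [K] is [- f' f'' / (r (1 - f'^2)^2)], so [K > 0]
   makes [f'^2] strictly decreasing in [r]: it cannot tend to [0] as [r -> 0].
   Conversely, with [<N, v> = c / sqrt (1 - f'^2)] the translator equation is a
   separable equation for [1 - f'^2]; the solution vanishing at [r = 0] is, for
   [c = q^alpha] and [q = 2 alpha / (1 - 2 alpha)], the function [r^(2q)]. *)
Require Import Defs.
From Stdlib Require Import Reals Lra.
From Coquelicot Require Import Coquelicot.
Open Scope R_scope.

(** * Bilinear algebra in Minkowski space *)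

Lemma vec_ext (p q : vec) : cx p = cx q -> cy p = cy q -> cz p = cz q -> p = q.
Proof.
destruct p as [[p1 p2] p3], q as [[q1 q2] q3]; cbn; intros -> -> ->; reflexivity.
Qed.

Lemma ldot_sym (p q : vec) : ldot p q = ldot q p.
Proof. unfold ldot; ring. Qed.

Lemma ldot_plus_l (p q w : vec) : ldot (plus p q) w = ldot p w + ldot q w.
Proof.
destruct p as [[p1 p2] p3], q as [[q1 q2] q3].
unfold ldot, cx, cy, cz; cbn; unfold plus; cbn; ring.
Qed.

Lemma ldot_scal_l (k : R) (p w : vec) : ldot (scal k p) w = k * ldot p w.
Proof.
destruct p as [[p1 p2] p3].
unfold ldot, cx, cy, cz; cbn; unfold scal, mult; cbn; unfold mult; cbn; ring.
Qed.

Lemma ldot_opp_l (p w : vec) : ldot (opp p) w = - ldot p w.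
Proof.
destruct p as [[p1 p2] p3].
unfold ldot, cx, cy, cz; cbn; unfold opp; cbn; ring.
Qed.

Definition unit_x : vec := (1, 0, 0).
Definition unit_y : vec := (0, 1, 0).
Definition unit_z : vec := (0, 0, 1).

Lemma linear_map_coord (L : vec -> vec) (x y z : R) : linear_map L ->
  L (x, y, z) = plus (plus (scal x (L unit_x)) (scal y (L unit_y))) (scal z (L unit_z)).
Proof.
intros [Lplus Lscal].
rewrite <- !Lscal, <- !Lplus; f_equal.
apply vec_ext; unfold cx, cy, cz, unit_x, unit_y, unit_z, plus, scal, mult; cbn;
  unfold plus, scal, mult; cbn; unfold mult; cbn; ring.
Qed.

(** Only the three numbers [ldot w (L e_i)] matter when [w] is the normal or one of its derivatives,
    so an arbitrary rigid motion is carried along without reducing it to the identity. *)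
Lemma ldot_linear_map (L : vec -> vec) (w : vec) (x y z : R) : linear_map L ->
  ldot w (L (x, y, z)) = x * ldot w (L unit_x) + y * ldot w (L unit_y) + z * ldot w (L unit_z).
Proof.
intros linL; rewrite (linear_map_coord L x y z linL), ldot_sym.
rewrite !ldot_plus_l, !ldot_scal_l, !(ldot_sym w); reflexivity.
Qed.

(** * Derivatives of the moved surface and of its normal *)

Lemma d_u_rot_surface (phi L : vec -> vec) (b : vec) (f : R -> R) (r t : R) :
  linear_map L -> (forall p, phi p = plus (L p) b) -> ex_derive f r ->
  d_u (rot_surface phi f) r t = L (cos t, sin t, Derive f r).
Proof.
intros linL phiE fdiff.
rewrite (linear_map_coord L _ _ _ linL).
apply vec_ext; unfold d_u; cbn; apply is_derive_unique;
  (eapply is_derive_ext;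
   [intros s; unfold rot_surface; rewrite phiE, (linear_map_coord L _ _ _ linL); reflexivity|]);
  unfold cx, cy, cz, plus, scal, mult; cbn; unfold plus, scal, mult; cbn;
  unfold mult; cbn; auto_derive; auto;
  change (Derive (fun x => f x) r) with (Derive f r); ring.
Qed.

Lemma d_v_rot_surface (phi L : vec -> vec) (b : vec) (f : R -> R) (r t : R) :
  linear_map L -> (forall p, phi p = plus (L p) b) ->
  d_v (rot_surface phi f) r t = L (- (r * sin t), r * cos t, 0).
Proof.
intros linL phiE.
rewrite (linear_map_coord L _ _ _ linL).
apply vec_ext; unfold d_v; cbn; apply is_derive_unique;
  (eapply is_derive_ext;
   [intros s; unfold rot_surface; rewrite phiE, (linear_map_coord L _ _ _ linL); reflexivity|]);
  unfold cx, cy, cz, plus, scal, mult; cbn; unfold plus, scal, mult; cbn;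
  unfold mult; cbn; auto_derive; auto; ring.
Qed.

(** The vector [w] is constant, so only the derivative of [N] survives in the product rule; order 1
    of [smooth_on] supplies differentiability of the coordinates. *)
Lemma is_derive_ldot_u (U : R -> R -> Prop) (N : R -> R -> vec) (w : vec) (u v : R) :
  smooth_on U N -> U u v ->
  is_derive (fun s => ldot (N s v) w) u (ldot (d_u N u v) w).
Proof.
intros smN Uuv.
destruct (smN 1%nat u v Uuv) as [[_ [hx _]] [[_ [hy _]] [_ [hz _]]]].
unfold ldot.
set (gx := fun s => cx (N s v)) in *; set (gy := fun s => cy (N s v)) in *.
set (gz := fun s => cz (N s v)) in *.
change (is_derive (fun s => gx s * cx w + gy s * cy w - gz s * cz w) u
  (Derive gx u * cx w + Derive gy u * cy w - Derive gz u * cz w)).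
auto_derive.
- repeat split; assumption.
- change (Derive (fun x => gx x) u) with (Derive gx u).
  change (Derive (fun x => gy x) u) with (Derive gy u).
  change (Derive (fun x => gz x) u) with (Derive gz u); ring.
Qed.

Lemma is_derive_ldot_v (U : R -> R -> Prop) (N : R -> R -> vec) (w : vec) (u v : R) :
  smooth_on U N -> U u v ->
  is_derive (fun s => ldot (N u s) w) v (ldot (d_v N u v) w).
Proof.
intros smN Uuv.
destruct (smN 1%nat u v Uuv) as [[_ [_ [hx _]]] [[_ [_ [hy _]]] [_ [_ [hz _]]]]].
unfold ldot.
set (gx := fun s => cx (N u s)) in *; set (gy := fun s => cy (N u s)) in *.
set (gz := fun s => cz (N u s)) in *.
change (is_derive (fun s => gx s * cx w + gy s * cy w - gz s * cz w) v
  (Derive gx v * cx w + Derive gy v * cy w - Derive gz v * cz w)).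
auto_derive.
- repeat split; assumption.
- change (Derive (fun x => gx x) v) with (Derive gx v).
  change (Derive (fun x => gy x) v) with (Derive gy v).
  change (Derive (fun x => gz x) v) with (Derive gz v); ring.
Qed.

(** * Differentiated tangency relations and the sign of $f'f''$ *)

(** This differentiates an identity valid only near a point, such as the tangency relations on
    $0<r<\delta$. *)
Lemma is_derive_locally_zero (g : R -> R) (x l : R) :
  locally x (fun y => g y = 0) -> is_derive g x l -> l = 0.
Proof.
intros g0 gl.
rewrite <- (is_derive_unique _ _ _ gl), (Derive_ext_loc g (fun _ => 0) x g0).
apply Derive_const.
Qed.

Lemma locally_Ioo (a b x : R) : a < x < b -> locally x (fun y => a < y < b).
Proof.
intros [ax xb].
exact (locally_interval (fun y => a < y < b) x a b ax xb (fun y h1 h2 => conj h1 h2)).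
Qed.

(* With [n_i = <N, L e_i>], tangency gives
   [n_1 cos t + n_2 sin t + f' n_3 = 0 = - n_1 sin t + n_2 cos t]; differentiating
   these, [K] is [- f' f''] times a nonnegative factor. *)
Lemma rotational_K_translator_profile (alpha : R) (speed : vec) (phi : vec -> vec)
    (f : R -> R) (delta r : R) :
  rotational_K_translator alpha speed phi f delta -> 0 < r < delta ->
  Derive f r * Derive (Derive f) r < 0.
Proof.
intros [[L [b [linL [isoL phiE]]]] [_ [fsm [[_ spl] [N [[smN Nperp] trans]]]]]] hr.
assert (f1 : forall s, 0 < s < delta -> ex_derive f s) by exact (fsm 1%nat).
assert (f2 : forall s, 0 < s < delta -> ex_derive (Derive f) s) by exact (fsm 2%nat).
set (n1 := fun s t => ldot (N s t) (L unit_x)).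
set (n2 := fun s t => ldot (N s t) (L unit_y)).
set (n3 := fun s t => ldot (N s t) (L unit_z)).
assert (tan1 : forall s t, 0 < s < delta ->
  cos t * n1 s t + sin t * n2 s t + Derive f s * n3 s t = 0).
{ intros s t hs; destruct (Nperp s t hs) as [h _].
  rewrite (d_u_rot_surface phi L b f s t linL phiE (f1 s hs)) in h.
  rewrite (ldot_linear_map L _ _ _ _ linL) in h; exact h. }
assert (tan2 : forall s t, 0 < s < delta -> - sin t * n1 s t + cos t * n2 s t = 0).
{ intros s t hs; destruct (Nperp s t hs) as [_ [h _]].
  rewrite (d_v_rot_surface phi L b f s t linL phiE) in h.
  rewrite (ldot_linear_map L _ _ _ _ linL) in h; fold (n1 s t) (n2 s t) in h.
  apply (Rmult_eq_reg_l s); [|lra].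
  rewrite Rmult_0_r, <- h; ring. }
(* From here on everything is evaluated on the meridian $\theta=0$, where $X_u=L(1,0,f')$ and
   $X_v=L(0,r,0)$. *)
assert (dn1 := is_derive_ldot_u _ N (L unit_x) r 0 smN hr).
assert (dn2 := is_derive_ldot_u _ N (L unit_y) r 0 smN hr).
assert (dn3 := is_derive_ldot_u _ N (L unit_z) r 0 smN hr).
assert (en2 := is_derive_ldot_v _ N (L unit_y) r 0 smN hr).
assert (en1 := is_derive_ldot_v _ N (L unit_x) r 0 smN hr).
set (m1 := ldot (d_u N r 0) (L unit_x)) in *.
set (m2 := ldot (d_u N r 0) (L unit_y)) in *.
set (m3 := ldot (d_u N r 0) (L unit_z)) in *.
set (k1 := ldot (d_v N r 0) (L unit_x)) in *.
set (k2 := ldot (d_v N r 0) (L unit_y)) in *.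
(* The radial derivative of [tan1] along $\theta=0$. *)
assert (T1 : m1 + Derive f r * m3 + Derive (Derive f) r * n3 r 0 = 0).
{ apply (is_derive_locally_zero (fun s => n1 s 0 + Derive f s * n3 s 0) r).
  - apply (filter_imp (fun y => 0 < y < delta)); [|now apply locally_Ioo].
    intros y hy; assert (h := tan1 y 0 hy); rewrite cos_0, sin_0 in h; lra.
  - auto_derive.
    + repeat split; [eexists; exact dn1|exact (f2 r hr)|eexists; exact dn3].
    + change (1 * Derive (fun s => n1 s 0) r + (1 * Derive (Derive f) r * n3 r 0
        + Derive f r * (1 * Derive (fun s => n3 s 0) r))
        = m1 + Derive f r * m3 + Derive (Derive f) r * n3 r 0).
      replace (Derive (fun s => n1 s 0) r) with m1 by (symmetry; exact (is_derive_unique _ _ _ dn1)).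
      replace (Derive (fun s => n3 s 0) r) with m3 by (symmetry; exact (is_derive_unique _ _ _ dn3)).
      ring. }
(* The angular derivative of [tan2] at $\theta=0$, where the terms carrying $\sin\theta$ vanish. *)
assert (T2 : k2 = n1 r 0).
{ cut (k2 - n1 r 0 = 0); [lra|].
  apply (is_derive_locally_zero (fun t => - sin t * n1 r t + cos t * n2 r t) 0).
  - apply filter_forall; intros t; now apply tan2.
  - auto_derive.
    + repeat split; [eexists; exact en1|eexists; exact en2].
    + replace (Derive (fun s => n2 r s) 0) with k2
        by (symmetry; exact (is_derive_unique _ _ _ en2)).
      rewrite sin_0, cos_0; ring. }
assert (P1 := tan1 r 0 hr); rewrite cos_0, sin_0 in P1.
(* This is $\langle X_u,X_u\rangle>0$: the metric is tested on the coefficients $(1,0)$. *)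
assert (E0 : 0 < 1 - Derive f r ^ 2).
{ assert (h := spl r 0 hr 1 0 ltac:(intros e; injection e; lra)); cbv zeta in h.
  rewrite ldot_plus_l, !ldot_scal_l, Rmult_0_l, Rplus_0_r, Rmult_1_l in h.
  rewrite ldot_sym, ldot_plus_l, !ldot_scal_l, Rmult_0_l, Rplus_0_r, Rmult_1_l in h.
  rewrite (d_u_rot_surface phi L b f r 0 linL phiE (f1 r hr)), isoL in h.
  unfold ldot, cx, cy, cz in h; cbn in h; rewrite cos_0, sin_0 in h; lra. }
destruct (trans r 0 hr) as [K [[a11 [a12 [a21 [a22 [[W1 W2] ->]]]]] [K0 _]]].
destruct (Nperp r 0 hr) as [_ [_ NN]]; rewrite NN in K0.
rewrite (d_u_rot_surface phi L b f r 0 linL phiE (f1 r hr)),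
  (d_v_rot_surface phi L b f r 0 linL phiE), cos_0, sin_0 in W1, W2.
(* Pairing with the orthogonal vectors $L(1,0,f')$ and $L(0,1,0)$ isolates [a11], [a21] and [a22] in
   turn. Since [a21] turns out to be 0, the determinant is [a11 * a22] and [a12] need not be
   computed. *)
assert (A1 := f_equal (fun w => ldot w (L (1, 0, Derive f r))) W1).
assert (A2 := f_equal (fun w => ldot w (L (0, 1, 0))) W1).
assert (A3 := f_equal (fun w => ldot w (L (0, 1, 0))) W2).
assert (A4 := tan2 r 0 hr); rewrite cos_0, sin_0 in A4.
assert (T3 : m2 = 0).
{ apply (is_derive_locally_zero (fun s => n2 s 0) r); [|exact dn2].
  apply (filter_imp (fun y => 0 < y < delta)); [|now apply locally_Ioo].
  intros y hy; assert (h := tan2 y 0 hy); rewrite cos_0, sin_0 in h; lra. }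
cbv beta in A1, A2, A3.
rewrite ldot_opp_l, ldot_plus_l, !ldot_scal_l, !isoL, (ldot_linear_map L _ _ _ _ linL) in A1.
rewrite ldot_opp_l, ldot_plus_l, !ldot_scal_l, !isoL, (ldot_linear_map L _ _ _ _ linL) in A2.
rewrite ldot_opp_l, ldot_plus_l, !ldot_scal_l, !isoL, (ldot_linear_map L _ _ _ _ linL) in A3.
fold m1 m2 m3 in A1, A2; fold k2 k1 in A3.
unfold ldot, cx, cy, cz in A1, A2, A3; cbn in A1, A2, A3.
set (p := Derive f r) in *; set (q := Derive (Derive f) r) in *.
assert (a21 = 0) as -> by (apply (Rmult_eq_reg_r r); lra).
assert (B1 : a11 * (1 - p ^ 2) = q * n3 r 0) by lra.
assert (B2 : a22 * r = p * n3 r 0) by lra.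
assert (B3 : (a11 * a22) * ((1 - p ^ 2) * r) = (p * q) * n3 r 0 ^ 2).
{ transitivity ((a11 * (1 - p ^ 2)) * (a22 * r)); [ring|rewrite B1, B2; ring]. }
assert (0 < (1 - p ^ 2) * r) by (apply Rmult_lt_0_compat; lra).
assert (a11 * a22 < 0) by lra.
(* If $f'f''\ge0$, the right side of [B3] is nonnegative while its left side is negative. *)
destruct (Rlt_or_le (p * q) 0) as [?|pq]; [assumption|exfalso].
assert (0 <= (p * q) * n3 r 0 ^ 2) by (apply Rmult_le_pos; [assumption|apply pow2_ge_0]).
nra.
Qed.

(** * No orthogonal intersection with the axis *)

Lemma rotational_K_translator_not_orthogonal (alpha : R) (speed : vec) (phi : vec -> vec)
    (f : R -> R) (delta : R) :
  rotational_K_translator alpha speed phi f delta -> ~ meets_axis_orthogonally f.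
Proof.
intros tr [_ lim].
assert (d0 : 0 < delta) by (destruct tr as [_ [h _]]; exact h).
assert (f2 : forall s, 0 < s < delta -> ex_derive (Derive f) s).
{ destruct tr as [_ [_ [fsm _]]]; exact (fsm 2%nat). }
assert (decr : forall x y, 0 < x -> x < y -> y < delta -> Derive f y ^ 2 < Derive f x ^ 2).
{ intros x y x0 xy yd.
  (* [incr_function] treats increasing functions, hence the passage to $-f'^2$, whose derivative is
     $-2f'f''>0$. *)
  apply Ropp_lt_cancel.
  apply (incr_function (fun s => - Derive f s ^ 2) 0 delta
           (fun s => - (2 * (Derive f s * Derive (Derive f) s)))); [| |exact x0|exact xy|exact yd].
  - intros s s0 sd; auto_derive; [exact (f2 s (conj s0 sd))|].
    change (Derive (fun x => Derive f x) s) with (Derive (Derive f) s); ring.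
  - intros s s0 sd.
    assert (h := rotational_K_translator_profile _ _ _ _ _ s tr (conj s0 sd)); lra. }
(* With a third of [delta], the point [2 * x0] is still in the domain, and
   $f'(x_0)^2>f'(2x_0)^2\ge0$. Closer to the axis $f'^2$ exceeds this positive value, against the
   limit 0. *)
set (x0 := delta / 3).
assert (pos : 0 < Derive f x0 ^ 2).
{ apply Rle_lt_trans with (Derive f (2 * x0) ^ 2); [apply pow2_ge_0|].
  unfold x0; apply decr; lra. }
assert (lim2 : filterlim (fun r => Derive f r ^ 2) (at_right 0) (locally (0 ^ 2))).
{ apply (filterlim_comp _ _ _ (fun r => Derive f r) (fun y => y ^ 2) _ (locally 0) _ lim).
  apply (ex_derive_continuous (fun y : R => y ^ 2)); auto_derive; exact I. }
assert (near : at_right 0 (fun r => Derive f r ^ 2 < Derive f x0 ^ 2)).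
{ apply (lim2 (fun y => y < Derive f x0 ^ 2)).
  apply (locally_interval _ _ m_infty (Derive f x0 ^ 2)); cbn; [exact I|lra|].
  intros y _ h; exact h. }
assert (small : at_right 0 (fun r => 0 < r < x0)).
{ exists (mkposreal x0 ltac:(unfold x0; lra)); intros y hy y0; split; [exact y0|].
  apply Rabs_def2 in hy; cbn in hy; unfold minus, plus, opp in hy; cbn in hy; lra. }
destruct (filter_ex _ (filter_and _ _ near small)) as [r [h1 [h2 h3]]].
assert (h := decr r x0 h2 h3 ltac:(unfold x0; lra)); lra.
Qed.

(** * Real powers, extended continuously by zero *)

Lemma is_derive_Rpower (a x : R) : 0 < x ->
  is_derive (fun y => Rpower y a) x (a * Rpower x (a - 1)).
Proof. intros x0; apply is_derive_Reals; now apply derivable_pt_lim_power. Qed.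

Lemma Rpower_pred (a x : R) : 0 < x -> Rpower x (a - 1) = Rpower x a / x.
Proof.
intros x0; unfold Rminus, Rdiv.
now rewrite Rpower_plus, Rpower_Ropp, Rpower_1.
Qed.

Lemma Rpower_lt_1 (a x : R) : 0 < a -> 0 < x < 1 -> Rpower x a < 1.
Proof.
intros a0 [x0 x1].
replace 1 with (Rpower 1 a) by (unfold Rpower; rewrite ln_1, Rmult_0_r; apply exp_0).
apply Rlt_Rpower_l; lra.
Qed.

(* [Rpower x a] is [1], not [0], at [x <= 0]. *)
Definition pos_power (a x : R) : R := if Rlt_dec 0 x then Rpower x a else 0.

Lemma pos_powerE (a x : R) : 0 < x -> pos_power a x = Rpower x a.
Proof. intros x0; unfold pos_power; destruct (Rlt_dec 0 x); [reflexivity|lra]. Qed.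

Lemma pos_power0 (a x : R) : x <= 0 -> pos_power a x = 0.
Proof. intros x0; unfold pos_power; destruct (Rlt_dec 0 x); [lra|reflexivity]. Qed.

Lemma locally_pos (x : R) : 0 < x -> locally x (fun y => 0 < y).
Proof.
intros x0; apply (locally_interval _ x 0 p_infty); [exact x0|exact I|now intros y h _].
Qed.

Lemma continuous_pos_power (a x : R) : 0 < a -> continuous (pos_power a) x.
Proof.
intros a0; destruct (total_order_T x 0) as [[xneg| ->]|xpos].
- apply (continuous_ext_loc _ (fun _ => 0)); [|apply continuous_const].
  apply (locally_interval _ x m_infty 0); [exact I|exact xneg|].
  intros y _ y0; cbn in y0; symmetry; apply pos_power0; lra.
- apply filterlim_locally; intros eps.
  assert (e0 := cond_pos eps).
  (* The radius is $\varepsilon^{1/a}$, whose $a$-th power is $\varepsilon$. *)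
  assert (d0 : 0 < Rpower eps (/ a)) by apply exp_pos.
  exists (mkposreal _ d0); intros y hy.
  rewrite (pos_power0 a 0) by lra.
  apply Rabs_def2 in hy; unfold minus, plus, opp in hy; cbn in hy.
  change (Rabs (pos_power a y - 0) < eps); rewrite Rminus_0_r.
  destruct (Rlt_or_le 0 y) as [y0|y0].
  + rewrite pos_powerE by exact y0; rewrite Rabs_pos_eq by (apply Rlt_le, exp_pos).
    replace (pos eps) with (Rpower (Rpower eps (/ a)) a).
    * apply Rlt_Rpower_l; lra.
    * rewrite Rpower_mult, Rinv_l, Rpower_1; lra.
  + rewrite pos_power0, Rabs_R0 by exact y0; exact e0.
- apply (continuous_ext_loc _ (fun y => Rpower y a)).
  + apply (filter_imp (fun y => 0 < y)); [|now apply locally_pos].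
    intros y y0; symmetry; now apply pos_powerE.
  + apply (ex_derive_continuous (fun y => Rpower y a)).
    eexists; now apply is_derive_Rpower.
Qed.

(** * The conical profile and its slope *)

Section ConicalProfile.

Variable q : R.
Hypothesis q0 : 0 < q.

(** Chosen as $f'$ so that $1-f'^2=r^{2q}$ on $0<r<1$. It is continuous on the whole line: its value
    is 1 for $r\le0$, and 0 for $r\ge1$ because [sqrt] vanishes on negative numbers. Hence it has a
    primitive differentiable at the axis too. *)
Definition slope (r : R) : R := sqrt (1 - pos_power q r ^ 2).

Definition profile (r : R) : R := RInt slope 0 r.

Lemma continuous_slope (r : R) : continuous slope r.
Proof.
apply (continuous_comp (fun r => 1 - pos_power q r ^ 2) sqrt); [|apply continuous_sqrt].
apply (continuous_comp (pos_power q) (fun y => 1 - y ^ 2)).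
- now apply continuous_pos_power.
- apply (ex_derive_continuous (fun y : R => 1 - y ^ 2)); auto_derive; exact I.
Qed.

Lemma is_derive_profile (r : R) : is_derive profile r (slope r).
Proof.
apply (is_derive_RInt slope profile 0); [|apply continuous_slope].
apply filter_forall; intros s; apply (RInt_correct slope 0 s).
apply ex_RInt_continuous; intros; apply continuous_slope.
Qed.

Lemma slope0 : slope 0 = 1.
Proof.
unfold slope; rewrite pos_power0 by lra.
replace (1 - 0 ^ 2) with 1 by ring; apply sqrt_1.
Qed.

Lemma slope_radicand_pos (r : R) : 0 < r < 1 -> 0 < 1 - Rpower r q ^ 2.
Proof.
intros hr; assert (0 < Rpower r q) by apply exp_pos.
assert (h := Rpower_lt_1 q r q0 hr); nra.
Qed.

Lemma slope_pos (r : R) : 0 < r < 1 -> 0 < slope r.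
Proof.
intros hr; unfold slope; rewrite pos_powerE by lra.
now apply sqrt_lt_R0, slope_radicand_pos.
Qed.

Lemma slope_sqr (r : R) : 0 < r < 1 -> slope r ^ 2 = 1 - Rpower r q ^ 2.
Proof.
intros hr; unfold slope; rewrite pos_powerE by lra.
now apply pow2_sqrt, Rlt_le, slope_radicand_pos.
Qed.

(** The derivative is kept as a product of powers and [/ slope r], which are generators of the
    algebra of smooth functions built below. *)
Lemma is_derive_slope (r : R) : 0 < r < 1 ->
  is_derive slope r (- q * Rpower r q * Rpower r (q - 1) * / slope r).
Proof.
intros hr.
apply (is_derive_ext_loc (fun s => sqrt (1 - Rpower s q ^ 2))).
- apply (filter_imp (fun y => 0 < y)); [|apply locally_pos; lra].
  intros y y0; unfold slope; now rewrite pos_powerE.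
- evar_last.
  + apply (is_derive_sqrt (fun s => 1 - Rpower s q ^ 2)); [|now apply slope_radicand_pos].
    apply (is_derive_minus (fun _ => 1) (fun s => Rpower s q ^ 2)); [apply is_derive_const|].
    apply (is_derive_pow (fun s => Rpower s q) 2); apply is_derive_Rpower; lra.
  + assert (s0 := slope_pos r hr); revert s0.
    unfold slope; rewrite pos_powerE by lra; intros s0.
    unfold minus, plus, opp, zero; cbn; field; apply Rgt_not_eq; exact s0.
Qed.

Lemma is_derive_inv_slope (r : R) : 0 < r < 1 ->
  is_derive (fun s => / slope s) r
    (q * Rpower r q * Rpower r (q - 1) * (/ slope r * (/ slope r * / slope r))).
Proof.
intros hr; assert (s0 := slope_pos r hr).
evar_last.
- apply is_derive_inv; [now apply is_derive_slope|lra].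
- field; lra.
Qed.

(** * Smoothness through an algebra closed under differentiation *)

(* On [0 < r < 1] this algebra is closed under both partial derivatives, hence
   consists of smooth functions. *)
Inductive generated : (R -> R -> R) -> Prop :=
| gen_const c : generated (fun _ _ => c)
| gen_radius : generated (fun r _ => r)
| gen_power a : generated (fun r _ => Rpower r a)
| gen_slope : generated (fun r _ => slope r)
| gen_inv_slope : generated (fun r _ => / slope r)
| gen_profile : generated (fun r _ => profile r)
| gen_cos : generated (fun _ t => cos t)
| gen_sin : generated (fun _ t => sin t)
| gen_plus F G : generated F -> generated G -> generated (fun r t => F r t + G r t)
| gen_mult F G : generated F -> generated G -> generated (fun r t => F r t * G r t).

Lemma generated_radial (g dg : R -> R) : generated (fun r _ => dg r) ->
  (forall r, 0 < r < 1 -> is_derive g r (dg r)) ->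
  exists Fu Fv, generated Fu /\ generated Fv /\
    forall r t : R, 0 < r < 1 -> is_derive (fun s => g s) r (Fu r t) /\
                             is_derive (fun _ : R => g r) t (Fv r t).
Proof.
intros gdg dgE; exists (fun r _ => dg r), (fun _ _ => 0).
split; [exact gdg|split; [apply gen_const|intros r t hr]].
split; [now apply dgE|apply @is_derive_const].
Qed.

Lemma generated_angular (g dg : R -> R) : generated (fun _ t => dg t) ->
  (forall t, is_derive g t (dg t)) ->
  exists Fu Fv, generated Fu /\ generated Fv /\
    forall r t : R, 0 < r < 1 -> is_derive (fun _ : R => g t) r (Fu r t) /\
                             is_derive (fun s => g s) t (Fv r t).
Proof.
intros gdg dgE; exists (fun _ _ => 0), (fun _ t => dg t).
split; [apply gen_const|split; [exact gdg|intros r t hr]].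
split; [apply @is_derive_const|now apply dgE].
Qed.

Lemma generated_derive (F : R -> R -> R) : generated F ->
  exists Fu Fv, generated Fu /\ generated Fv /\
    forall r t, 0 < r < 1 -> is_derive (fun s => F s t) r (Fu r t) /\
                             is_derive (fun s => F r s) t (Fv r t).
Proof.
intros genF; induction genF as
  [c| |a| | | | | |F G _ (Fu & Fv & gFu & gFv & dF) _ (Gu & Gv & gGu & gGv & dG)
  |F G gF (Fu & Fv & gFu & gFv & dF) gG (Gu & Gv & gGu & gGv & dG)].
- apply (generated_radial (fun _ => c) (fun _ => 0)); [apply gen_const|].
  intros; apply @is_derive_const.
- apply (generated_radial (fun r => r) (fun _ => 1)); [apply gen_const|].
  intros; apply @is_derive_id.
- apply (generated_radial (fun r => Rpower r a) (fun r => a * Rpower r (a - 1))).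
  + apply (gen_mult (fun _ _ => a)); constructor.
  + intros r [hr _]; now apply is_derive_Rpower.
- apply (generated_radial slope (fun r => - q * Rpower r q * Rpower r (q - 1) * / slope r)).
  + apply (gen_mult (fun r _ => - q * Rpower r q * Rpower r (q - 1))); [|constructor].
    apply (gen_mult (fun r _ => - q * Rpower r q)); [|constructor].
    apply (gen_mult (fun r _ => - q)); constructor.
  + exact is_derive_slope.
- apply (generated_radial _ (fun r => q * Rpower r q * Rpower r (q - 1)
           * (/ slope r * (/ slope r * / slope r)))).
  + apply (gen_mult (fun r _ => q * Rpower r q * Rpower r (q - 1))
             (fun r _ => / slope r * (/ slope r * / slope r))).
    * apply (gen_mult (fun r _ => q * Rpower r q)); [|constructor].
      apply (gen_mult (fun r _ => q)); constructor.
    * apply (gen_mult (fun r _ => / slope r)); [constructor|].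
      apply (gen_mult (fun r _ => / slope r)); constructor.
  + exact is_derive_inv_slope.
- apply (generated_radial profile slope); [constructor|].
  intros; apply is_derive_profile.
(* The sign is written as the constant factor -1, since the algebra has constants and products but
   no constructor for opposites. *)
- apply (generated_angular cos (fun t => -1 * sin t)).
  + apply (gen_mult (fun _ _ => -1)); constructor.
  + intros t; auto_derive; [exact I|ring].
- apply (generated_angular sin cos); [constructor|].
  intros t; auto_derive; [exact I|ring].
- exists (fun r t => Fu r t + Gu r t), (fun r t => Fv r t + Gv r t).
  split; [now apply gen_plus|split; [now apply gen_plus|]].
  intros r t hr; destruct (dF r t hr), (dG r t hr).
  split; [apply (is_derive_plus (fun s => F s t))|apply (is_derive_plus (fun s => F r s))];
    assumption.
- exists (fun r t => Fu r t * G r t + F r t * Gu r t),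
    (fun r t => Fv r t * G r t + F r t * Gv r t).
  split; [apply gen_plus; now apply gen_mult|split; [apply gen_plus; now apply gen_mult|]].
  intros r t hr; destruct (dF r t hr), (dG r t hr).
  split; [apply (is_derive_mult (fun s => F s t) (fun s => G s t))
         |apply (is_derive_mult (fun s => F r s) (fun s => G r s))]; try assumption;
    exact Rmult_comm.
Qed.

Lemma continuity_2d_pt_radial (g : R -> R) (l r t : R) : is_derive g r l ->
  continuity_2d_pt (fun r _ => g r) r t.
Proof.
intros dg; apply (continuity_1d_2d_pt_comp g (fun r _ => r)); [|apply continuity_2d_pt_id1].
apply continuity_pt_filterlim, (ex_derive_continuous g); now exists l.
Qed.

(** [ex_diff_n] asks at each order for joint continuity in both variables, which the separate
    partial derivatives do not give. *)
Lemma generated_continuity (F : R -> R -> R) (r t : R) : generated F -> 0 < r < 1 ->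
  continuity_2d_pt F r t.
Proof.
intros genF hr; induction genF.
- apply continuity_2d_pt_const.
- apply continuity_2d_pt_id1.
- eapply continuity_2d_pt_radial, is_derive_Rpower; lra.
- eapply continuity_2d_pt_radial, is_derive_slope; exact hr.
- eapply continuity_2d_pt_radial, is_derive_inv_slope; exact hr.
- eapply continuity_2d_pt_radial, is_derive_profile.
- apply (continuity_1d_2d_pt_comp cos (fun _ t => t)); [|apply continuity_2d_pt_id2].
  apply continuity_cos.
- apply (continuity_1d_2d_pt_comp sin (fun _ t => t)); [|apply continuity_2d_pt_id2].
  apply continuity_sin.
- now apply continuity_2d_pt_plus.
- now apply continuity_2d_pt_mult.
Qed.

Lemma locally_2d_strip (P : R -> R -> Prop) (r t : R) : 0 < r < 1 ->
  (forall u v, 0 < u < 1 -> P u v) -> locally_2d P r t.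
Proof.
intros hr HP; destruct (locally_Ioo 0 1 r hr) as [d hd].
exists d; intros u v hu _; apply HP, hd; exact hu.
Qed.

(** Induction on the order, for all generated functions at once: the partial derivatives are again
    generated, but agree with generated functions only on the strip, whence the local
    extensionality. *)
Lemma generated_ex_diff_n (n : nat) (F : R -> R -> R) (r t : R) : generated F -> 0 < r < 1 ->
  ex_diff_n F n r t.
Proof.
revert F; induction n as [|n IH]; intros F genF hr.
- split; [now apply generated_continuity|exact I].
- destruct (generated_derive F genF) as (Fu & Fv & gFu & gFv & dF).
  split; [now apply generated_continuity|].
  destruct (dF r t hr) as [du dv].
  split; [eexists; exact du|split; [eexists; exact dv|split]].
  + apply (ex_diff_n_ext_loc Fu); [|now apply IH].
    apply locally_2d_strip; [exact hr|intros u v hu].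
    symmetry; apply is_derive_unique; exact (proj1 (dF u v hu)).
  + apply (ex_diff_n_ext_loc Fv); [|now apply IH].
    apply locally_2d_strip; [exact hr|intros u v hu].
    symmetry; apply is_derive_unique; exact (proj2 (dF u v hu)).
Qed.

(** Transfers the closure property to functions of one variable, by freezing the angle at 0; it
    serves the smoothness of [profile] itself. *)
Lemma generated_Derive_n (n : nat) (F : R -> R -> R) : generated F ->
  exists G, generated G /\ forall r, 0 < r < 1 -> Derive_n (fun s => F s 0) n r = G r 0.
Proof.
intros genF; induction n as [|n (G & gG & GE)]; [now exists F|].
destruct (generated_derive G gG) as (Gu & Gv & gGu & _ & dG).
exists Gu; split; [exact gGu|intros r hr; cbn].
rewrite (Derive_ext_loc _ (fun s => G s 0)).
- apply is_derive_unique; exact (proj1 (dG r 0 hr)).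
- apply (filter_imp (fun y => 0 < y < 1)); [exact GE|now apply locally_Ioo].
Qed.

Lemma ex_derive_n_profile (n : nat) (r : R) : 0 < r < 1 -> ex_derive_n profile n r.
Proof.
intros hr; destruct n as [|n]; [exact I|cbn].
destruct (generated_Derive_n n _ gen_profile) as (G & gG & GE).
destruct (generated_derive G gG) as (Gu & Gv & _ & _ & dG).
apply (ex_derive_ext_loc (fun s => G s 0)).
- apply (filter_imp (fun y => 0 < y < 1)); [|now apply locally_Ioo].
  intros y hy; symmetry; now apply GE.
- eexists; exact (proj1 (dG r 0 hr)).
Qed.

(** * Geometry of the conical surface *)

Definition cone_surface : R -> R -> vec := rot_surface (fun p => p) profile.

(** This is $(f'\cos\theta,f'\sin\theta,1)/\sqrt{1-f'^2}$, with $\sqrt{1-f'^2}=r^q$. *)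
Definition cone_normal (r t : R) : vec :=
  (slope r * Rpower r (- q) * cos t, slope r * Rpower r (- q) * sin t, Rpower r (- q)).

Lemma smooth_cone_surface : smooth_on (rot_domain 1) cone_surface.
Proof.
intros n r t hr; repeat split; apply generated_ex_diff_n; try exact hr.
- apply (gen_mult (fun r _ => r) (fun _ t => cos t)); constructor.
- apply (gen_mult (fun r _ => r) (fun _ t => sin t)); constructor.
- exact gen_profile.
Qed.

Lemma smooth_cone_normal : smooth_on (rot_domain 1) cone_normal.
Proof.
assert (gen_radial : generated (fun r _ => slope r * Rpower r (- q))).
{ apply (gen_mult (fun r _ => slope r)); constructor. }
intros n r t hr; repeat split; apply generated_ex_diff_n; try exact hr.
- apply (gen_mult _ (fun _ t => cos t) gen_radial); constructor.
- apply (gen_mult _ (fun _ t => sin t) gen_radial); constructor.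
- exact (gen_power (- q)).
Qed.

Lemma d_u_cone_surface (r t : R) : d_u cone_surface r t = (cos t, sin t, slope r).
Proof.
unfold d_u; cbn; unfold cx, cy, cz; cbn.
f_equal; [f_equal|]; apply is_derive_unique; [| |apply is_derive_profile];
  auto_derive; auto; ring.
Qed.

Lemma d_v_cone_surface (r t : R) : d_v cone_surface r t = (- (r * sin t), r * cos t, 0).
Proof.
unfold d_v; cbn; unfold cx, cy, cz; cbn.
f_equal; [f_equal|]; apply is_derive_unique; auto_derive; auto; ring.
Qed.

Lemma is_derive_slope_mult_power (r : R) : 0 < r < 1 ->
  is_derive (fun s => slope s * Rpower s (- q)) r (- (q * Rpower r (- q) / (r * slope r))).
Proof.
intros hr; assert (s0 := slope_pos r hr); assert (s2 := slope_sqr r hr).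
evar_last.
- apply (is_derive_mult slope (fun s => Rpower s (- q))).
  + now apply is_derive_slope.
  + apply is_derive_Rpower; lra.
  + exact Rmult_comm.
- unfold plus, mult; cbn; rewrite !Rpower_pred by lra.
  (* The factor $r^{2q}+f'^2$ is exhibited because it equals 1 by [slope_sqr]. *)
  transitivity (- (q * Rpower r (- q) * (Rpower r q ^ 2 + slope r ^ 2)) / (r * slope r)).
  + field; lra.
  + rewrite s2; field; lra.
Qed.

Lemma d_u_cone_normal (r t : R) : 0 < r < 1 ->
  d_u cone_normal r t = (- (q * Rpower r (- q) / (r * slope r)) * cos t,
    - (q * Rpower r (- q) / (r * slope r)) * sin t, - (q * Rpower r (- q) / r)).
Proof.
intros hr; unfold d_u; cbn; unfold cx, cy, cz; cbn.
assert (dg := is_derive_slope_mult_power r hr).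
f_equal; [f_equal|]; apply is_derive_unique.
- exact (is_derive_scal_l _ r _ (cos t) dg).
- exact (is_derive_scal_l _ r _ (sin t) dg).
- evar_last; [apply is_derive_Rpower; lra|].
  rewrite Rpower_pred by lra; field; lra.
Qed.

Lemma d_v_cone_normal (r t : R) :
  d_v cone_normal r t =
  (- (slope r * Rpower r (- q) * sin t), slope r * Rpower r (- q) * cos t, 0).
Proof.
unfold d_v; cbn; unfold cx, cy, cz; cbn.
f_equal; [f_equal|]; apply is_derive_unique; auto_derive; auto; ring.
Qed.

Lemma spacelike_cone_surface : spacelike_surface (rot_domain 1) cone_surface.
Proof.
split; [exact smooth_cone_surface|intros r t hr a b ab; cbv zeta].
rewrite d_u_cone_surface, d_v_cone_surface.
set (w := plus _ _).
(* The first fundamental form is $r^{2q}dr^2+r^2d\theta^2$, positive definite for $r>0$ and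
   degenerating at the axis. *)
assert (wE : ldot w w = (a * Rpower r q) ^ 2 + (b * r) ^ 2).
{ assert (cs := sin2_cos2 t); unfold Rsqr in cs; assert (s2 := slope_sqr r hr).
  transitivity (a ^ 2 * (sin t * sin t + cos t * cos t - slope r ^ 2)
                + b ^ 2 * r ^ 2 * (sin t * sin t + cos t * cos t)).
  - unfold w, ldot, cx, cy, cz, plus, scal, mult; cbn; unfold plus, scal, mult; cbn.
    unfold mult; cbn; ring.
  - rewrite cs, s2; ring. }
rewrite wE; assert (p0 : 0 < Rpower r q) by apply exp_pos.
assert (r0 : 0 < r) by (destruct hr; assumption).
destruct (Req_dec a 0) as [-> |a0]; [destruct (Req_dec b 0) as [-> |b0]|].
- now destruct ab.
- assert (h := pow2_gt_0 (b * r) ltac:(apply Rmult_integral_contrapositive; lra)); nra.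
- assert (h := pow2_gt_0 (a * Rpower r q) ltac:(apply Rmult_integral_contrapositive; lra)).
  assert (h' := pow2_ge_0 (b * r)); lra.
Qed.

Lemma unit_cone_normal : unit_normal (rot_domain 1) cone_surface cone_normal.
Proof.
split; [exact smooth_cone_normal|intros r t hr].
assert (cs := sin2_cos2 t); unfold Rsqr in cs; assert (s2 := slope_sqr r hr).
assert (pq : Rpower r (- q) * Rpower r q = 1).
{ rewrite <- Rpower_plus, Rplus_opp_l; apply Rpower_O; destruct hr; assumption. }
rewrite d_u_cone_surface, d_v_cone_surface.
unfold ldot, cx, cy, cz, cone_normal; cbn; repeat split.
- transitivity (slope r * Rpower r (- q) * ((sin t * sin t + cos t * cos t) - 1)); [ring|].
  rewrite cs; ring.
- ring.
- transitivity (Rpower r (- q) ^ 2 * (slope r ^ 2 * (sin t * sin t + cos t * cos t) - 1)); [ring|].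
  rewrite cs, s2; transitivity (- (Rpower r (- q) * Rpower r q) ^ 2); [ring|].
  rewrite pq; ring.
Qed.

(** The coordinate directions are principal, with curvatures $q r^{-q-1}/f'$ and $-f' r^{-q-1}$. In
    their product $f'$ cancels, and $\epsilon=-1$ makes $K$ a positive multiple of a pure power of
    $r$. *)
Lemma gauss_curvature_cone (r t : R) : 0 < r < 1 ->
  gauss_curvature cone_surface cone_normal r t (q * Rpower r (- (2 * q + 2))).
Proof.
intros hr; assert (s0 := slope_pos r hr).
assert (r0 : 0 < r) by (destruct hr; assumption).
exists (q * Rpower r (- q) / (r * slope r)), 0, 0, (- (slope r * Rpower r (- q) / r)).
split.
- unfold weingarten_matrix.
  rewrite (d_u_cone_normal r t hr), d_v_cone_normal, d_u_cone_surface, d_v_cone_surface.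
  split; apply vec_ext; unfold cx, cy, cz, opp, plus, scal, mult; cbn;
    unfold opp, plus, scal, mult; cbn; unfold mult; cbn; field; lra.
- destruct (proj2 unit_cone_normal r t hr) as [_ [_ ->]].
  (* The exponent is split so that [Rpower_pred] turns each -1 into a division by [r]. *)
  replace (- (2 * q + 2)) with (- q + - q - 1 - 1) by ring.
  rewrite !Rpower_pred, Rpower_plus by exact r0; field; lra.
Qed.

(** The relation between [q] and [alpha] makes $K^\alpha=q^\alpha r^{-q}$, a constant times the last
    coordinate of the normal. The speed points down because the metric is negative on the
    $z$-axis. *)
Lemma K_translator_cone (alpha : R) : (2 * q + 2) * alpha = q ->
  K_translator alpha (0, 0, - Rpower q alpha) (rot_domain 1) cone_surface.
Proof.
intros qE; split; [exact spacelike_cone_surface|].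
exists cone_normal; split; [exact unit_cone_normal|intros r t hr].
assert (p0 : 0 < Rpower r (- (2 * q + 2))) by apply exp_pos.
exists (q * Rpower r (- (2 * q + 2))).
split; [now apply gauss_curvature_cone|split; [now apply Rmult_lt_0_compat|]].
rewrite <- Rpower_mult_distr, Rpower_mult by assumption.
replace (- (2 * q + 2) * alpha) with (- q) by (rewrite <- qE at 1; ring).
unfold ldot, cx, cy, cz, cone_normal; cbn; ring.
Qed.

Lemma profile_conical : meets_axis_at_conical_point profile.
Proof.
(* Both one-sided limits come from two-sided continuity at 0, since [profile] and [slope] are
   defined and continuous across the axis. *)
assert (within : forall g : R -> R, continuous g 0 -> filterlim g (at_right 0) (locally (g 0))).
{ intros g cg; exact (filterlim_filter_le_1 g (filter_le_within (F := locally 0) (fun r => 0 < r)) cg). }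
split.
- exists (profile 0); apply within, (ex_derive_continuous profile).
  eexists; apply is_derive_profile.
- replace 1 with (slope 0 ^ 2) by (rewrite slope0; ring).
  apply (filterlim_ext (fun r => slope r ^ 2)).
  + intros r; now rewrite (is_derive_unique _ _ _ (is_derive_profile r)).
  + apply (within (fun r => slope r ^ 2)).
    apply (continuous_comp slope (fun y => y ^ 2)); [apply continuous_slope|].
    apply (ex_derive_continuous (fun y : R => y ^ 2)); auto_derive; exact I.
Qed.

End ConicalProfile.

(** * Choice of the exponent and conclusion *)

Lemma rigid_motion_id : rigid_motion (fun p => p).
Proof.
exists (fun p => p), (0, 0, 0); repeat split.
intros p; symmetry; exact (plus_zero_r p).
Qed.

Lemma conical_rotational_K_translator (alpha : R) : 0 < alpha < 1 / 2 ->
  exists (speed : vec) (phi : vec -> vec) (f : R -> R) (delta : R),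
    rotational_K_translator alpha speed phi f delta /\ meets_axis_at_conical_point f.
Proof.
(* The solution of $(2q+2)\alpha=q$; it is positive because $0<\alpha<1/2$. *)
intros ha; set (q := 2 * alpha / (1 - 2 * alpha)).
assert (q0 : 0 < q) by (apply Rdiv_lt_0_compat; lra).
(* The radius 1 keeps $1-r^{2q}$ positive, so that the slope is smooth and nonzero. *)
exists (0, 0, - Rpower q alpha), (fun p => p), (profile q), 1.
split; [|now apply profile_conical].
split; [exact rigid_motion_id|split; [lra|split]].
- intros n r; now apply ex_derive_n_profile.
- apply K_translator_cone; [exact q0|unfold q; field; lra].
Qed.

Theorem corollary3p4 :
  (forall alpha : R, alpha <> 0 ->
     ~ exists (speed : vec) (phi : vec -> vec) (f : R -> R) (delta : R),
         rotational_K_translator alpha speed phi f delta /\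
         meets_axis_orthogonally f) /\
  (forall alpha : R, 0 < alpha < 1 / 2 ->
     exists (speed : vec) (phi : vec -> vec) (f : R -> R) (delta : R),
       rotational_K_translator alpha speed phi f delta /\
       meets_axis_at_conical_point f).
Proof.
split; [|exact conical_rotational_K_translator].
intros alpha _ (speed & phi & f & delta & tr & orth).
exact (rotational_K_translator_not_orthogonal alpha speed phi f delta tr orth).
Qed.
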